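(* Let $d\geq 3$ and $d_1$ be integers with $1 \leq d_1 < d/2$ and set $d_2 = d-1-d_1$. Consider the line arrangement $\mathcal{A} : f=0$ of $d$ lines in $\mathbb{P}^2$ (over $\mathbb{C}$) given by $$f(x,y,z)= x\,g_{1,d_1}(x,y)\,g_{1,d_2}(x,z)=0,$$ where for integers $i\le j$, $g_{i,j}(u,v)=(u-iv)(u-(i+1)v)\cdots(u-jv)$. Then the following holds. (1) The line arrangement $\mathcal{A}$ is free with exponents $(d_1,d_2)$. (2) The line arrangement $\mathcal{A}$ has at most two points of multiplicity $>2$.
   Context: Let $S=\mathbb{C}[x,y,z]$ with its standard grading. For a reduced curve $C:f=0$ of degree $d$ in $\mathbb{P}^2$ (in particular a line arrangement, where $f$ is a product of $d$ pairwise non-proportional linear forms), with partial derivatives $f_x,f_y,f_z$, let $AR(f)=\{(a,b,c)\in S^3 : af_x+bf_y+cf_z=0\}$ be the graded $S$-module of Jacobian syzygies; a homogeneous syzygy has degree $m$ if $a,b,c$ are homogeneous of degree $m$. The curve $C$ is free with exponents $(d_1,d_2)$, $d_1\le d_2$, if $AR(f)$ is a free graded $S$-module of rank 2 with a homogeneous basis consisting of syzygies of degrees $d_1$ and $d_2$; then necessarily $d_1+d_2=d-1$. The multiplicity of a point of a line arrangement is the number of lines of the arrangement passing through it. *)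

(* Defs.v *)
From mathcomp Require Export all_boot all_order all_algebra.
From mathcomp Require Export reals complex mpoly.
Set Implicit Arguments.
Unset Strict Implicit.
Unset Printing Implicit Defensive.
Import Order.TTheory GRing.Theory Num.Theory.
Local Open Scope ring_scope.

(* The complex numbers are R[i] for R : realType, and S = C[x,y,z] is
   {mpoly R[i][3]}, with x, y, z the variables 'X_0, 'X_1, 'X_2. *)

Definition varx (R : realType) : {mpoly R[i][3]} := 'X_(inord 0).
Definition vary (R : realType) : {mpoly R[i][3]} := 'X_(inord 1).
Definition varz (R : realType) : {mpoly R[i][3]} := 'X_(inord 2).

Definition g (R : realType) (i j : nat) (u v : {mpoly R[i][3]}) :
    {mpoly R[i][3]} :=
  \prod_(i <= k < j.+1) (u - k%:R * v).

Section Syzygies.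
Variable R : realType.
Local Notation S := {mpoly R[i][3]}.

Definition AR (f : S) : pred 'rV[S]_3 :=
  fun r => \sum_(i < 3) r 0 i * f^`M(i) == 0.

Definition homogeneous_of_degree (m : nat) (r : 'rV[S]_3) : Prop :=
  forall i : 'I_3, r 0 i \is m.-homog.

(* Since 0 belongs to AR f, the uniqueness of the coefficients c contains the
   linear independence over S of the two syzygies. *)
Definition free_with_exponents (f : S) (d1 d2 : nat) : Prop :=
  (d1 <= d2)%N /\
  exists r1 r2 : 'rV[S]_3,
    [/\ r1 \in AR f /\ homogeneous_of_degree d1 r1,
        r2 \in AR f /\ homogeneous_of_degree d2 r2
      & forall r : 'rV[S]_3, r \in AR f ->
          exists! c : S * S, r = c.1 *: r1 + c.2 *: r2].

End Syzygies.

Section LineArrangements.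
Variable R : realType.
Local Notation S := {mpoly R[i][3]}.

Definition linear_form (l : S) : Prop := l != 0 /\ l \is 1.-homog.

Definition proportional (l m : S) : Prop :=
  exists2 a : R[i], a != 0 & l = a *: m.

(* A lists the lines of the arrangement f = 0, each line being given by one of
   its equations. *)
Definition line_arrangement (A : seq S) (f : S) : Prop :=
  [/\ forall l, l \in A -> linear_form l,
      forall i j, (i < j < size A)%N -> ~ proportional A`_i A`_j
    & f = \prod_(l <- A) l].

(* A point of the projective plane is a line through the origin of C^3. *)
Definition P2 : Type := {U : {vspace 'rV[R[i]]_3} | \dim U == 1%N}.

(* [vpick] selects a nonzero vector of the line p; as l is homogeneous, its
   vanishing there does not depend on the choice. *)
Definition passes_through (l : S) (p : P2) : bool :=
  l.@[fun i => vpick (val p) 0 i] == 0.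

Definition multiplicity (A : seq S) (p : P2) : nat :=
  count (fun l => passes_through l p) A.

Definition at_most (n : nat) (Q : P2 -> Prop) : Prop :=
  forall s : seq P2, uniq s -> (forall p, p \in s -> Q p) -> (size s <= n)%N.

End LineArrangements.

(* Main.v *)
From HB Require Import structures.
Require Import Defs.
From mathcomp Require Import ring zify.
Import Order.TTheory GRing.Theory Num.Theory.
Local Open Scope ring_scope.

Set Implicit Arguments.
Unset Strict Implicit.
Unset Printing Implicit Defensive.

(** The Euler field E, P d/dy and Q d/dz, where P = g_{1,d1}(x,y) and
    Q = g_{1,d2}(x,z), are logarithmic for f = x P Q: the second multiplies f by
    P_y, the third by Q_z.  Subtracting multiples of E yields the syzygies
    P d/dy - (P_y/d) E and Q d/dz - (Q_z/d) E.  They generate: in a syzygy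
    (a,b,c), reducing modulo x shows that x divides a = x a'; removing a' E,
    reduction modulo the linear factors of P and of Q shows that P divides
    b - a' y and Q divides c - a' z.

    The multiplicity of a point is the order of vanishing of f along a line
    through it in the direction (1,0,0), which no line of the arrangement
    contains; hence it does not depend on how f is factored into linear forms,
    and for the obvious factors it exceeds 2 only at (0:0:1) and (0:1:0). *)

(** * Substitution for one variable and divisibility by linear factors *)

Section Substitution.
Variables (K : comNzRingType) (n : nat).
Local Notation S := {mpoly K[n]}.
Variable i0 : 'I_n.

(** This morphism stands for reduction modulo ['X_i0 - s] without quotient rings: a polynomial
    differs from its image by a multiple of ['X_i0 - s]. *)
Definition subst (s p : S) : S :=
  p \mPo [tuple if i == i0 then s else 'X_i | i < n].

Lemma subst_is_zmod_morphism s : zmod_morphism (subst s).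
Proof. exact: comp_mpolyB. Qed.

Lemma subst_is_monoid_morphism s : monoid_morphism (subst s).
Proof. by split; [exact: comp_mpoly1 | move=> p q; rewrite /subst rmorphM]. Qed.

HB.instance Definition _ s := GRing.isZmodMorphism.Build S S (subst s)
  (subst_is_zmod_morphism s).
HB.instance Definition _ s := GRing.isMonoidMorphism.Build S S (subst s)
  (subst_is_monoid_morphism s).

Lemma subst_var s : subst s 'X_i0 = s.
Proof. by rewrite /subst comp_mpolyXU -tnth_nth tnth_mktuple eqxx. Qed.

Lemma subst_other s j : j != i0 -> subst s 'X_j = 'X_j.
Proof.
by move=> ji; rewrite /subst comp_mpolyXU -tnth_nth tnth_mktuple (negPf ji).
Qed.

(** The property holds for the variables and is stable under linear combinations and, writing [p1 p2
    - p1' p2' = (p1 - p1') p2 + p1' (p2 - p2')], under products. *)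
Lemma subst_factor s p : exists q, p - subst s p = ('X_i0 - s) * q.
Proof.
pose good p := exists q, p - subst s p = ('X_i0 - s) * q.
have goodM p1 p2 : good p1 -> good p2 -> good (p1 * p2).
  move=> [q1 e1] [q2 e2]; exists (q1 * p2 + subst s p1 * q2).
  rewrite mulrDr mulrA -e1 mulrCA -e2 rmorphM /=; ring.
have goodX j : good 'X_j.
  have [->|ji] := eqVneq j i0; first by exists 1; rewrite subst_var mulr1.
  by exists 0; rewrite subst_other // subrr mulr0.
have goodXm m : good 'X_[m].
  rewrite mpolyXE_id; elim/big_ind: _ => //.
    by exists 0; rewrite rmorph1 subrr mulr0.
  move=> i _; elim: (m i) => [|k IHk]; last by rewrite exprS; apply: goodM.
  by exists 0; rewrite rmorph1 subrr mulr0.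
elim/mpolyind: p => [|c m p _ _ [q eq]].
  by exists 0; rewrite rmorph0 subrr mulr0.
have [q1 eq1] := goodXm m.
exists (c *: q1 + q); rewrite mulrDr -eq -scalerAr -eq1 rmorphD /=.
by rewrite /subst comp_mpolyZ scalerBr; ring.
Qed.

End Substitution.

(** The factors are split off one at a time. Putting [F k] for ['X_i0] in the factors already split
    off leaves differences [F k - F x], nonzero by injectivity, so the cofactor vanishes too and is
    divisible by the next factor. That [subst] fixes each [F k] says that [F k] does not involve
    ['X_i0]. *)
Lemma dvd_prod_linear (K : idomainType) (n : nat) (i0 : 'I_n) (T : eqType)
    (r : seq T) (F : T -> {mpoly K[n]}) (p : {mpoly K[n]}) :
  uniq r -> {in r &, injective F} ->
  (forall k s, k \in r -> subst i0 s (F k) = F k) ->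
  (forall k, k \in r -> subst i0 (F k) p = 0) ->
  exists q, p = \prod_(k <- r) ('X_i0 - F k) * q.
Proof.
elim: r => [|k r IHr] /= in p *; first by exists p; rewrite big_nil mul1r.
case/andP=> kr ur Finj Ffix p0.
have [|||q eq] := IHr p ur.
- by move=> x y xr yr; apply: Finj; rewrite inE ?xr ?yr orbT.
- by move=> x s xr; apply: Ffix; rewrite inE xr orbT.
- by move=> x xr; apply: p0; rewrite inE xr orbT.
have [q' eq'] := subst_factor i0 (F k) q.
exists q'; rewrite big_cons eq -mulrA mulrCA -eq'.
suff -> : subst i0 (F k) q = 0 by rewrite subr0.
have /eqP := p0 k (mem_head _ _).
rewrite eq rmorphM /= mulf_eq0 => /orP[|/eqP //].
rewrite rmorph_prod /= prodf_seq_eq0 => /hasP[x xr] /=.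
rewrite rmorphB /= subst_var Ffix ?inE ?xr ?orbT // subr_eq0 => /eqP eqF.
case/negP: kr; suff -> : k = x by [].
by apply: Finj eqF; rewrite !inE ?eqxx ?xr ?orbT.
Qed.

(** * Euler's identity, partial derivatives and homogeneity *)

Lemma euler_identity (K : comNzRingType) n m (p : {mpoly K[n]}) :
  p \is m.-homog -> \sum_(i < n) 'X_i * p^`M(i) = m%:R * p.
Proof.
move=> /dhomogP hp; under eq_bigr => i _ do rewrite /mderiv mulr_sumr.
rewrite exchange_big /= {3}[p]mpolyE mulr_sumr !big_seq.
apply: eq_bigr => u up; have -> : m = mdeg u by rewrite -(hp u up).
rewrite mdegE natr_sum mulr_suml.
apply: eq_bigr => i _; rewrite -scalerAr !mulr_natl scalerMnl.
(* Subtraction of exponents is truncated, so multiplying by ['X_i] restores the monomial [u] only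
   when [u i] is positive; otherwise both sides are zero. *)
have [->|ui] := posnP (u i); first by rewrite mulr0n !scale0r.
rewrite -mpolyXD; congr (_ *: 'X_[_]); apply/mnmP => j.
rewrite !mnmE; case: eqP => [<-|_] /=; lia.
Qed.

Lemma mderiv_var (K : nzRingType) n (i j : 'I_n) :
  ('X_i : {mpoly K[n]})^`M(j) = (i == j)%:R.
Proof.
rewrite mderivX mnm1E; case: eqP => [->|_]; last by rewrite scale0r.
rewrite scale1r -mpolyX0; congr 'X_[_]; apply/mnmP => k.
by rewrite !mnmE subnn.
Qed.

Lemma mderiv_prod0 (K : comNzRingType) n (T : Type) (r : seq T) (P : pred T)
    (F : T -> {mpoly K[n]}) i :
  (forall t, (F t)^`M(i) = 0) -> (\prod_(t <- r | P t) F t)^`M(i) = 0.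
Proof.
move=> F0; elim/big_ind: _ => [|p q p0 q0|t _]; last exact: F0.
  by rewrite -mpolyC1 mderivC.
by rewrite mderivM p0 q0 mul0r mulr0 addr0.
Qed.

Lemma dhomog_mderiv (K : nzRingType) n k (p : {mpoly K[n]}) i :
  p \is k.-homog -> p^`M(i) \is k.-1.-homog.
Proof.
move=> /dhomogP hp; apply/dhomogP => u; rewrite mcoeff_msupp mcoeff_deriv.
move=> nz; have /hp : (u + U_(i))%MM \in msupp p.
  by rewrite mcoeff_msupp; apply: contraNneq nz => ->; rewrite mul0rn.
by move=> /= <-; rewrite mdegD mdeg1 addn1.
Qed.

Lemma dhomogMS (K : comNzRingType) n k (p l : {mpoly K[n]}) :
  p \is k.-homog -> l \is 1.-homog -> p * l \is k.+1.-homog.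
Proof. by rewrite -(addn1 k); exact: dhomogM. Qed.

(** * Restriction of linear forms to a line, and orders of vanishing *)

Lemma meval_linear_form (K : comNzRingType) n (p w : 'I_n -> K)
    (l : {mpoly K[n]}) : l \is 1.-homog ->
  mmap polyC (fun i => (p i)%:P + w i *: 'X) l = (l.@[p])%:P + l.@[w] *: 'X.
Proof.
move=> /dhomogP hl; rewrite /meval /mmap.
rewrite raddf_sum scaler_suml -big_split /= !big_seq.
apply: eq_bigr => m /hl /eqP /mdeg1P [i /eqP ->].
by rewrite !mmap1U /= mulrDr -polyCM -mul_polyC mulrA -polyCM mul_polyC.
Qed.

(** Along a direction on which it does not vanish, a linear form has a simple zero at a point where
    it vanishes, and none at any other point. *)
Lemma mup0_linear (K : fieldType) (a b : K) :
  b != 0 -> mup 0 (a%:P + b *: 'X) = (a == 0).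
Proof.
move=> b0; have [->|a0] := eqVneq a 0; last first.
  by rewrite mupNroot // rootE !hornerE.
rewrite add0r -mul_polyC mupMr ?rootC //.
by have := mup_XsubCX 1 (0 : K) 0; rewrite polyC0 subr0 expr1 eqxx.
Qed.

Lemma mup_prod (K : fieldType) (T : Type) (r : seq T) (F : T -> {poly K}) a :
  all (fun t => F t != 0) r ->
  mup a (\prod_(t <- r) F t) = (\sum_(t <- r) mup a (F t))%N.
Proof.
elim: r => [|t r IHr] /=; first by rewrite !big_nil mupNroot // root1.
case/andP=> Ft Fr; rewrite !big_cons mupM ?IHr //.
by rewrite prodf_seq_neq0; apply: sub_all Fr.
Qed.

(** * Indices of the three variables *)

Local Notation o0 := (inord 0 : 'I_3).
Local Notation o1 := (inord 1 : 'I_3).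
Local Notation o2 := (inord 2 : 'I_3).

Lemma o01 : (o0 == o1) = false. Proof. by rewrite -val_eqE /= !inordK. Qed.
Lemma o02 : (o0 == o2) = false. Proof. by rewrite -val_eqE /= !inordK. Qed.
Lemma o12 : (o1 == o2) = false. Proof. by rewrite -val_eqE /= !inordK. Qed.
Definition oE := (o01, o02, o12,
  etrans (eq_sym o1 o0) o01, etrans (eq_sym o2 o0) o02,
  etrans (eq_sym o2 o1) o12).

Lemma eq_ord3 (P : 'I_3 -> Prop) : P o0 -> P o1 -> P o2 -> forall i, P i.
Proof.
move=> P0 P1 P2 [[|[|[|//]]] lti].
- by rewrite (_ : Ordinal lti = o0) //; apply: val_inj; rewrite /= inordK.
- by rewrite (_ : Ordinal lti = o1) //; apply: val_inj; rewrite /= inordK.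
- by rewrite (_ : Ordinal lti = o2) //; apply: val_inj; rewrite /= inordK.
Qed.

Section Free.
Variable R : realType.
Local Notation S := {mpoly R[i][3]}.

(** * The products of the linear forms x - k x_j, and their derivatives *)

Section LinearProduct.
Variables (m : nat) (j : 'I_3).
Hypothesis j0 : j != o0.
Local Notation P := (g 1 m (varx R) 'X_j).

Lemma natvarE k : k%:R * 'X_j = k%:R *: ('X_j : S).
Proof. by rewrite mulr_natl scaler_nat. Qed.

Lemma g_homog : P \is m.-homog.
Proof.
rewrite /g; elim: m => [|k IHk]; first by rewrite big_geq // dhomog1.
rewrite big_nat_recr //=; apply: dhomogMS => //.
by rewrite natvarE rpredB ?rpredZ // dhomogX /= mdeg1.
Qed.

Lemma mderiv_g_other i : i != o0 -> i != j -> P^`M(i) = 0.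
Proof.
move=> i0 ij; apply: mderiv_prod0 => k.
rewrite natvarE mderivB mderivZ !mderiv_var (eq_sym o0) (eq_sym j).
by rewrite (negPf i0) (negPf ij) scaler0 subr0.
Qed.

Lemma subst_natvar (s : S) k : subst o0 s (k%:R * 'X_j) = k%:R * 'X_j.
Proof. by rewrite rmorphM rmorph_nat /= subst_other. Qed.

Lemma natvar_inj : injective (fun k : nat => k%:R * 'X_j : S).
Proof.
move=> k k' /(congr1 (meval (fun i => (i == j)%:R))).
rewrite !mevalM !mevalXU !rmorph_nat eqxx !mulr1 => /eqP.
by rewrite eqr_nat => /eqP.
Qed.

Lemma subst_g_neq0 (s : S) :
  (forall k, (0 < k)%N -> s <> k%:R * 'X_j) -> subst o0 s P != 0.
Proof.
move=> sk; rewrite rmorph_prod prodf_seq_neq0; apply/allP => k /=.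
rewrite mem_index_iota => /andP[k0 _].
by rewrite rmorphB /= subst_var subst_natvar subr_eq0; apply/eqP/sk.
Qed.

Lemma subst_g0 k : (0 < k <= m)%N -> subst o0 (k%:R * 'X_j) P = 0.
Proof.
move=> km; rewrite rmorph_prod /= (bigD1_seq k) ?iota_uniq //=; last first.
  by rewrite mem_index_iota; lia.
by rewrite rmorphB /= subst_var subst_natvar subrr mul0r.
Qed.

(** The factor x - k x_j is simple in P. By the product rule, only the term differentiating this
    factor survives at x = k x_j; it is -k, nonzero as k is positive, times the product of the (k -
    k') x_j. *)
Lemma subst_mderiv_g_neq0 k :
  (0 < k <= m)%N -> subst o0 (k%:R * 'X_j) P^`M(j) != 0.
Proof.
move=> km; rewrite /g (bigD1_seq k) ?iota_uniq //=; last first.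
  by rewrite mem_index_iota; lia.
rewrite mderivM natvarE mderivB mderivZ !mderiv_var eqxx (eq_sym o0) (negPf j0).
rewrite -natvarE rmorphD !rmorphM [in X in _ + X]rmorphB /= subst_var.
rewrite subst_natvar subrr mul0r addr0 mulf_neq0 //.
  rewrite sub0r rmorphN oppr_eq0 /= scaler_nat rmorph_nat.
  by rewrite -mpolyC_nat mpolyC_eq0 pnatr_eq0; case: k km.
rewrite rmorph_prod prodf_seq_neq0; apply/allP => k' _ /=; apply/implyP => k'k.
rewrite rmorphB /= subst_var subst_natvar subr_eq0 eq_sym.
by apply: contraNneq k'k => /natvar_inj ->.
Qed.

Lemma dvd_g (p : S) :
  (forall k, (0 < k <= m)%N -> subst o0 (k%:R * 'X_j) p = 0) ->
  exists q, p = P * q.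
Proof.
move=> p0; apply: dvd_prod_linear; first exact: iota_uniq.
- by move=> k k' _ _; exact: natvar_inj.
- by move=> k s _; exact: subst_natvar.
- by move=> k; rewrite mem_index_iota => km; apply: p0; lia.
Qed.

End LinearProduct.

(** Together with [dvd_g], this turns a relation modulo P into divisibility of [b] by P, one linear
    factor at a time. *)
Lemma dvd_subst_eq0 (P b h u s : S) :
  b * h = P * u -> subst o0 s P = 0 -> subst o0 s h != 0 -> subst o0 s b = 0.
Proof.
move=> eq P0 h0; apply: (mulIf h0).
by rewrite mul0r -rmorphM /= eq rmorphM /= P0 mul0r.
Qed.

(** * Jacobian syzygies of x P Q *)

Lemma sum_ord3 (V : nmodType) (F : 'I_3 -> V) :
  \sum_(i < 3) F i = F o0 + F o1 + F o2.
Proof.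
rewrite !big_ord_recl big_ord0 addr0 addrA; congr (F _ + F _ + F _);
  by apply: val_inj; rewrite /= inordK.
Qed.

Lemma row_combE (n : nat) (c1 c2 : S) (r1 r2 : 'rV[S]_n) i :
  (c1 *: r1 + c2 *: r2) 0 i = c1 * r1 0 i + c2 * r2 0 i.
Proof. by rewrite !mxE. Qed.

Definition row3 (a b c : S) : 'rV[S]_3 := \row_i [:: a; b; c]`_i.

Lemma row3E a b c :
  (row3 a b c 0 o0 = a) * (row3 a b c 0 o1 = b) * (row3 a b c 0 o2 = c).
Proof. by rewrite !mxE !inordK. Qed.

Lemma in_AR (f : S) r :
  (r \in AR f) =
  (r 0 o0 * f^`M(o0) + r 0 o1 * f^`M(o1) + r 0 o2 * f^`M(o2) == 0).
Proof. by have <- := sum_ord3 (fun i => r 0 i * f^`M(i)). Qed.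

(** P is free of z and Q of y. The linear factors are hidden in the last two hypotheses, which
    express that P is coprime to Q P_y and Q to P Q_z; the rest is linear algebra with Euler's
    identity. *)
Lemma free_split (P Q : S) (m n : nat) :
  (0 < m <= n)%N -> P \is m.-homog -> Q \is n.-homog ->
  P^`M(o2) = 0 -> Q^`M(o1) = 0 -> subst o0 0 P != 0 -> subst o0 0 Q != 0 ->
  (forall b u, b * (Q * P^`M(o1)) = P * u -> exists q, b = P * q) ->
  (forall c u, c * (P * Q^`M(o2)) = Q * u -> exists q, c = Q * q) ->
  free_with_exponents ('X_o0 * P * Q) m n.
Proof.
move=> /andP[m0 mn] homP homQ Pz Qy P00 Q00 dvdP dvdQ.
have fy : ('X_o0 * P * Q)^`M(o1) = 'X_o0 * P^`M(o1) * Q.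
  by rewrite 2!mderivM Qy mderiv_var oE mul0r add0r mulr0 addr0.
have fz : ('X_o0 * P * Q)^`M(o2) = 'X_o0 * P * Q^`M(o2).
  by rewrite 2!mderivM Pz mderiv_var oE mul0r mulr0 addr0 mul0r add0r.
have homX i : ('X_i : S) \is 1.-homog by rewrite dhomogX /= mdeg1.
(* The degree of f, whose inverse [e] exists in characteristic zero. *)
pose d : S := (m + n).+1%:R.
have [e ed] : exists e : R[i], e%:MP * d = 1.
  exists ((m + n).+1%:R^-1).
  by rewrite /d -mpolyC_nat -mpolyCM mulVf ?pnatr_eq0.
have euler : 'X_o0 * ('X_o0 * P * Q)^`M(o0) +
    'X_o1 * ('X_o0 * P^`M(o1) * Q) + 'X_o2 * ('X_o0 * P * Q^`M(o2)) =
    d * ('X_o0 * P * Q).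
  rewrite -fy -fz -(euler_identity (m := (m + n).+1)) ?sum_ord3 //.
  by rewrite -mulrA mulrC; apply: dhomogMS; [exact: dhomogM | exact: homX].
have fx0 : subst o0 0 ('X_o0 * P * Q)^`M(o0) = subst o0 0 P * subst o0 0 Q.
  rewrite -mulrA mderivM mderiv_var eqxx mul1r rmorphD rmorphM /=.
  by rewrite [X in _ + X]rmorphM /= subst_var mul0r addr0.
have x0 : 'X_o0 != 0 :> S.
  apply/eqP => /(congr1 (meval (fun=> 1)))/eqP.
  by rewrite meval0 mevalXU oner_eq0.
have P0 : P != 0 by apply: contraNneq P00 => ->; rewrite rmorph0.
have Q0 : Q != 0 by apply: contraNneq Q00 => ->; rewrite rmorph0.
pose r1 := row3 (- (e%:MP * P^`M(o1) * 'X_o0)) (P - e%:MP * P^`M(o1) * 'X_o1)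
                (- (e%:MP * P^`M(o1) * 'X_o2)).
pose r2 := row3 (- (e%:MP * Q^`M(o2) * 'X_o0)) (- (e%:MP * Q^`M(o2) * 'X_o1))
                (Q - e%:MP * Q^`M(o2) * 'X_o2).
have hom1 : homogeneous_of_degree m r1.
  have h i : e%:MP * P^`M(o1) * 'X_i \is m.-homog.
    rewrite -(prednK m0); apply: dhomogMS => //.
    by rewrite mul_mpolyC rpredZ // dhomog_mderiv.
  by move=> i; elim/eq_ord3: i; rewrite /r1 !row3E ?rpredN ?rpredB //; exact: h.
have hom2 : homogeneous_of_degree n r2.
  have h i : e%:MP * Q^`M(o2) * 'X_i \is n.-homog.
    rewrite -(prednK (leq_trans m0 mn)); apply: dhomogMS => //.
    by rewrite mul_mpolyC rpredZ // dhomog_mderiv.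
  by move=> i; elim/eq_ord3: i; rewrite /r2 !row3E ?rpredN ?rpredB //; exact: h.
have syz1 : r1 \in AR ('X_o0 * P * Q).
  rewrite in_AR /r1 !row3E fy fz; apply/eqP; move: euler.
  (* The derivative f_x is made a variable, since only [euler] is used of it; the sum is then P f_y
     minus a multiple of Euler's identity. *)
  set fx := _^`M(o0); move: fx => fx euler.
  transitivity (P * ('X_o0 * P^`M(o1) * Q) - e%:MP * P^`M(o1) *
    ('X_o0 * fx + 'X_o1 * ('X_o0 * P^`M(o1) * Q)
                + 'X_o2 * ('X_o0 * P * Q^`M(o2)))).
    by ring.
  rewrite euler.
  transitivity ('X_o0 * P * Q * P^`M(o1) * (1 - e%:MP * d)); first by ring.
  by rewrite ed subrr mulr0.
have syz2 : r2 \in AR ('X_o0 * P * Q).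
  rewrite in_AR /r2 !row3E fy fz; apply/eqP; move: euler.
  set fx := _^`M(o0); move: fx => fx euler.
  transitivity (Q * ('X_o0 * P * Q^`M(o2)) - e%:MP * Q^`M(o2) *
    ('X_o0 * fx + 'X_o1 * ('X_o0 * P^`M(o1) * Q)
                + 'X_o2 * ('X_o0 * P * Q^`M(o2)))).
    by ring.
  rewrite euler.
  transitivity ('X_o0 * P * Q * Q^`M(o2) * (1 - e%:MP * d)); first by ring.
  by rewrite ed subrr mulr0.
split=> //; exists r1, r2; split=> // r; rewrite in_AR fy fz.
move: euler fx0; set fx := _^`M(o0); move: fx => fx euler fx0.
set a := r 0 o0; set b := r 0 o1; set c := r 0 o2 => /eqP syz.
(* Both f_y and f_z are multiples of x, so x divides a f_x; modulo x, f_x is P Q, which is nonzero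
   there. *)
have [a' aE] : exists a', a = 'X_o0 * a'.
  have [a' aE] := subst_factor o0 0 a; exists a'.
  rewrite subr0 in aE; rewrite -[RHS]aE; suff -> : subst o0 0 a = 0.
    by rewrite subr0.
  have eq : a * fx = 'X_o0 * - (b * P^`M(o1) * Q + c * P * Q^`M(o2)).
    by apply/eqP; rewrite -subr_eq0 -syz; apply/eqP; ring.
  apply: (dvd_subst_eq0 eq); first exact: subst_var.
  by rewrite fx0; exact: mulf_neq0 P00 Q00.
(* The field with the multiple a' E of the Euler field removed has no x component and sends f to -d
   a' f; the common factor x is cancelled. *)
have syz' : (b - a' * 'X_o1) * P^`M(o1) * Q + (c - a' * 'X_o2) * P * Q^`M(o2)
            = - d * a' * P * Q.
  apply: (mulfI x0).
  transitivity (a * fx + b * ('X_o0 * P^`M(o1) * Q) + c * ('X_o0 * P * Q^`M(o2))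
    - a' * ('X_o0 * fx + 'X_o1 * ('X_o0 * P^`M(o1) * Q)
                       + 'X_o2 * ('X_o0 * P * Q^`M(o2)))).
    by rewrite aE; ring.
  by rewrite syz euler; ring.
(* In [syz'] every term except the one containing [b] has the factor P. *)
have [b' bE] : exists b', b - a' * 'X_o1 = P * b'.
  apply: (dvdP _ (- d * a' * Q - (c - a' * 'X_o2) * Q^`M(o2))).
  rewrite mulrBr [RHS](_ : _ =
      - d * a' * P * Q - (c - a' * 'X_o2) * P * Q^`M(o2)).
    by rewrite -syz'; ring.
  by ring.
have [c' cE] : exists c', c - a' * 'X_o2 = Q * c'.
  apply: (dvdQ _ (- d * a' * P - (b - a' * 'X_o1) * P^`M(o1))).
  rewrite mulrBr [RHS](_ : _ =
      - d * a' * P * Q - (b - a' * 'X_o1) * P^`M(o1) * Q).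
    by rewrite -syz'; ring.
  by ring.
(* Cancelling P Q in [syz'] shows that a' is determined by b' and c', which are therefore the
   coordinates in the basis. *)
have a'E : a' = - e%:MP * (b' * P^`M(o1) + c' * Q^`M(o2)).
  have -> : b' * P^`M(o1) + c' * Q^`M(o2) = - d * a'.
    apply: (mulfI (mulf_neq0 P0 Q0)).
    transitivity (P * b' * P^`M(o1) * Q + Q * c' * P * Q^`M(o2)); first by ring.
    by rewrite -bE -cE syz'; ring.
  by rewrite mulrA mulrNN ed mul1r.
exists (b', c'); split => [|[b2 c2]] /=.
  apply/rowP => i; rewrite row_combE; elim/eq_ord3: i; rewrite /r1 /r2 !row3E.
  - by rewrite -/a aE a'E; ring.
  - by rewrite -/b -[b](subrK (a' * 'X_o1)) bE a'E; ring.
  - by rewrite -/c -[c](subrK (a' * 'X_o2)) cE a'E; ring.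
move=> rE; have rEi i : r 0 i = b2 * r1 0 i + c2 * r2 0 i.
  by rewrite rE row_combE.
have := rEi o0; have := rEi o1; have := rEi o2.
rewrite /r1 /r2 !row3E -/a -/b -/c => cE2 bE2 aE2.
(* The first component gives the formula of [a'E] for any coefficients, so the other two reduce to P
   b' = P b2 and Q c' = Q c2. *)
have a'E2 : a' = - e%:MP * (b2 * P^`M(o1) + c2 * Q^`M(o2)).
  by apply: (mulfI x0); rewrite -aE aE2; ring.
congr (_, _); [apply: (mulfI P0) | apply: (mulfI Q0)].
  by rewrite -bE bE2 a'E2; ring.
by rewrite -cE cE2 a'E2; ring.
Qed.

Lemma free_g (m n : nat) : (0 < m <= n)%N ->
  free_with_exponents
    (varx R * g 1 m (varx R) (vary R) * g 1 n (varx R) (varz R)) m n.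
Proof.
move=> mn; have o10 : o1 != o0 by rewrite oE.
have o20 : o2 != o0 by rewrite oE.
have neq0 (j : 'I_3) k : (0 < k)%N -> 0 <> k%:R * 'X_j :> S.
  move=> k0 /(congr1 (meval (fun=> 1)))/eqP; rewrite meval0 mevalM mevalXU.
  by rewrite rmorph_nat mulr1 eq_sym pnatr_eq0; case: k k0.
have neq_var (i j : 'I_3) k k' : i != j -> (0 < k')%N ->
    k%:R * 'X_i <> k'%:R * 'X_j :> S.
  move=> ij k'0 /(congr1 (meval (fun i => (i == j)%:R)))/eqP.
  rewrite !mevalM !mevalXU !rmorph_nat eqxx (negPf ij) mulr0 mulr1 eq_sym.
  by rewrite pnatr_eq0; case: k' k'0.
apply: free_split => //; try exact: g_homog.
- by apply: mderiv_g_other; rewrite ?oE.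
- by apply: mderiv_g_other; rewrite ?oE.
- by apply: subst_g_neq0 => // k; apply: neq0.
- by apply: subst_g_neq0 => // k; apply: neq0.
(* At x = k y, P vanishes, P_y does not, and Q becomes a product of forms k y - k' z with k'
   positive, none of them zero. *)
- move=> b u eq; apply: dvd_g => // k km.
  apply: (dvd_subst_eq0 eq); first exact: subst_g0.
  rewrite rmorphM mulf_neq0 ?subst_mderiv_g_neq0 //=.
  by apply: subst_g_neq0 => // k'; apply: neq_var; rewrite oE.
- move=> c u eq; apply: dvd_g => // k kn.
  apply: (dvd_subst_eq0 eq); first exact: subst_g0.
  rewrite rmorphM mulf_neq0 ?subst_mderiv_g_neq0 //=.
  by apply: subst_g_neq0 => // k'; apply: neq_var; rewrite oE.
Qed.

End Free.

(** * The lines of the arrangement and the multiplicities of its points *)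

Section Arrangements.
Variable R : realType.
Local Notation S := {mpoly R[i][3]}.

(** Each line through p contributes a simple zero at t = 0 to f(p + t w), and the other lines none.
    The right-hand side depends on [A] only through f. *)
Lemma multiplicity_mup (A : seq S) f (p : P2 R) (w : 'I_3 -> R[i]) :
  line_arrangement A f -> f.@[w] != 0 ->
  multiplicity A p =
  mup 0 (mmap polyC (fun i => (vpick (val p) 0 i)%:P + w i *: 'X) f).
Proof.
case=> linA _ -> fw; rewrite rmorph_prod /=.
have lw l : l \in A -> l.@[w] != 0.
  by move=> lA; move: fw; rewrite rmorph_prod prodf_seq_neq0 => /allP/(_ _ lA).
rewrite mup_prod; last first.
  apply/allP => l lA /=; have [_ hl] := linA l lA.
  rewrite meval_linear_form // -size_poly_eq0 addrC size_addl.
    by rewrite size_scale ?lw // size_polyX.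
  by rewrite size_scale ?lw // size_polyX size_polyC; case: eqP.
rewrite /multiplicity -sum1_count big_mkcond /= !big_seq.
apply: eq_bigr => l lA; have [_ hl] := linA l lA.
by rewrite meval_linear_form // mup0_linear ?lw // /passes_through; case: eqP.
Qed.

(** One family holds all the lines: (0, 0) is x = 0, while (k, 0) and (0, k) are the factors in x, y
    and in x, z. *)
Definition line (t : nat * nat) : S :=
  varx R - t.1%:R * vary R - t.2%:R * varz R.

Definition lines (m n : nat) : seq (nat * nat) :=
  (0, 0)%N :: [seq (k, 0)%N | k <- index_iota 1 m.+1] ++
              [seq (0, k)%N | k <- index_iota 1 n.+1].

Lemma meval_line v t : (line t).@[v] = v o0 - t.1%:R * v o1 - t.2%:R * v o2.
Proof. by rewrite !(mevalB, mevalM, mevalXU, rmorph_nat). Qed.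

(** The coefficient of x is 1 in both forms, so the proportionality factor is 1; evaluation at the
    unit vectors compares the other coefficients. *)
Lemma line_proportional_eq t u : proportional (line t) (line u) -> t = u.
Proof.
case=> a _ e; have ev v := congr1 (meval v) e.
have := ev (fun i => (i == o0)%:R).
rewrite mevalZ !meval_line !oE eqxx !mulr0 !subr0 mulr1 => a1.
have := ev (fun i => (i == o1)%:R); have := ev (fun i => (i == o2)%:R).
rewrite -a1 !mevalZ !meval_line !oE !eqxx !mulr0 !mulr1 !subr0 !sub0r !mul1r.
move=> /oppr_inj/eqP; rewrite eqr_nat => /eqP e2.
move=> /oppr_inj/eqP; rewrite eqr_nat => /eqP e1.
by move: e1 e2; case: t {e ev a1} => ? ?; case: u => ? ? /= -> ->.
Qed.

Lemma line_homog t : line t \is 1.-homog.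
Proof.
have h k i : k%:R * 'X_i \is [in R[i][3], 1.-homog].
  rewrite mulr_natl; apply: rpredMn; by rewrite dhomogX /= mdeg1.
by rewrite /line /varx /vary /varz !rpredB // dhomogX /= mdeg1.
Qed.

Lemma line_linear_form t : linear_form (line t).
Proof.
split; last exact: line_homog.
apply/eqP => /(congr1 (meval (fun i => (i == o0)%:R)))/eqP.
by rewrite meval_line !oE eqxx !mulr0 !subr0 meval0 oner_eq0.
Qed.

Lemma uniq_lines m n : uniq (lines m n).
Proof.
rewrite /= cat_uniq !map_inj_uniq ?iota_uniq; try by move=> ? ? [].
rewrite mem_cat !andbT; apply/andP; split.
  apply/negP => /orP[] /mapP[k]; rewrite mem_index_iota => + []; lia.
apply/hasPn => _ /mapP[k + ->]; rewrite mem_index_iota => k1.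
apply/negP => /mapP[k']; rewrite mem_index_iota => + []; lia.
Qed.

Lemma lines_arrangement m n :
  line_arrangement [seq line t | t <- lines m n]
    (varx R * g 1 m (varx R) (vary R) * g 1 n (varx R) (varz R)).
Proof.
split.
- by move=> _ /mapP[t _ ->]; exact: line_linear_form.
- move=> i j /andP[ij jn]; rewrite size_map in jn.
  rewrite !(nth_map (0, 0)%N) ?(ltn_trans ij) // => /line_proportional_eq /eqP.
  by rewrite nth_uniq ?uniq_lines ?(ltn_trans ij) // (ltn_eqF ij).
have e0 : line (0, 0)%N = varx R by rewrite /line !mul0r !subr0.
have e1 : g 1 m (varx R) (vary R) = \prod_(1 <= k < m.+1) line (k, 0)%N.
  by apply: eq_bigr => k _; rewrite /line mul0r subr0.
have e2 : g 1 n (varx R) (varz R) = \prod_(1 <= k < n.+1) line (0, k)%N.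
  by apply: eq_bigr => k _; rewrite /line mul0r subr0.
by rewrite /lines big_map big_cons big_cat !big_map e0 e1 e2 -mulrA.
Qed.

Lemma size_lines m n : size (lines m n) = (m + n).+1.
Proof. by rewrite /= size_cat !size_map !size_iota; lia. Qed.

Lemma count_uniq_le1 (T : eqType) (P : pred T) s :
  uniq s -> {in s &, forall x y, P x -> P y -> x = y} -> (count P s <= 1)%N.
Proof.
move=> us Pinj; rewrite -size_filter.
case E : (filter P s) => [//|x s'].
have xs : x \in filter P s by rewrite E mem_head.
rewrite -E -[1%N]/(size [:: x]); apply: uniq_leq_size; first exact: filter_uniq.
move: xs; rewrite mem_filter => /andP[Px xs] y.
rewrite mem_filter inE => /andP[Py ys]; exact/eqP/Pinj.
Qed.

(** If x is nonzero at v, then x = 0 is missed and each of the two pencils has at most one line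
    through v. If only x vanishes, x = 0 is the only line through v. *)
Lemma count_lines m n (v : 'I_3 -> R[i]) :
  (2 < count (fun l : S => l.@[v] == 0%R) [seq line t | t <- lines m n])%N ->
  v o0 = 0 /\ (v o1 = 0 \/ v o2 = 0).
Proof.
rewrite count_map /= count_cat !count_map meval_line !mul0r !subr0.
set b := (v o0 == 0); set c1 := count _ _; set c2 := count _ _.
have natI (a c : R[i]) k k' : c != 0 ->
    a - k%:R * c = 0 -> a - k'%:R * c = 0 -> k = k'.
  move=> c0 /eqP; rewrite subr_eq0 => /eqP-> /eqP.
  rewrite subr_eq0 => /eqP /(mulIf c0)/eqP.
  by rewrite eqr_nat => /eqP.
have c1E : c1 = count (fun k => v o0 - k%:R * v o1 == 0) (index_iota 1 m.+1).
  by apply: eq_count => k /=; rewrite meval_line mul0r subr0.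
have c2E : c2 = count (fun k => v o0 - k%:R * v o2 == 0) (index_iota 1 n.+1).
  by apply: eq_count => k /=; rewrite meval_line mul0r subr0.
have le1 (c : R[i]) r : (v o0 != 0) || (c != 0) ->
    (count (fun k => (v o0 - k%:R * c == 0)%R) (index_iota 1 r) <= 1)%N.
  move=> nz; apply: count_uniq_le1; first exact: iota_uniq.
  move=> k k' _ _ /eqP ek /eqP ek'; suff c0 : c != 0 by apply: natI ek ek'.
  case/orP: nz => // nz; apply: contraNneq nz => c0.
  by move: ek; rewrite c0 mulr0 subr0 => ->.
(* The range starts at 1, so k c is nonzero. *)
have eq0 (c : R[i]) r : v o0 = 0 -> c != 0 ->
    count (fun k => v o0 - k%:R * c == 0) (index_iota 1 r) = 0%N.
  move=> -> c0; apply/eqP; rewrite -leqn0 leqNgt -has_count; apply/hasPn => k.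
  rewrite mem_index_iota sub0r oppr_eq0 mulf_eq0 (negPf c0) orbF pnatr_eq0.
  by case: k.
have [v0|v0] := eqVneq (v o0) 0; last first.
  have := le1 (v o1) m.+1; have := le1 (v o2) n.+1.
  by rewrite -c1E -c2E /b (negPf v0) /=; lia.
have [v1|v1] := eqVneq (v o1) 0; first by split; [|left].
have [v2|v2] := eqVneq (v o2) 0; first by split; [|right].
by rewrite c1E c2E !eq0 // !addn0 => /leq_trans/(_ (leq_b1 b)).
Qed.

(** The chosen vector of p is a nonzero multiple of the unit vector, and p has dimension one. *)
Lemma P2_coordinate_point (p : P2 R) (o : 'I_3) :
  (forall i, i != o -> vpick (val p) 0 i = 0) ->
  val p = (<[delta_mx 0%R o]>)%VS.
Proof.
move=> p0; set u := vpick (val p) in p0 *.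
have dimp : \dim (val p) = 1%N by apply/eqP; exact: (valP p).
have uE : u = u 0 o *: delta_mx 0 o.
  apply/rowP => i; rewrite !mxE eqxx /=.
  have [->|io] := eqVneq i o; first by rewrite mulr1.
  by rewrite p0 // mulr0.
have u0 : u 0 o != 0.
  apply/eqP => c0; have : u == 0 by rewrite uE c0 scale0r.
  by rewrite vpick0 -dimv_eq0 dimp.
have e0 : delta_mx 0 o != 0 :> 'rV[R[i]]_3.
  by apply: contraNneq u0 => e0; rewrite uE e0 scaler0 mxE.
apply/esym/eqP; rewrite eqEdim dimp dim_vline e0 -memvE andbT.
by rewrite -[delta_mx _ _](scalerK u0) -uE memvZ ?memv_pick.
Qed.

Lemma at_most_two_multiple_points m n (A : seq S) :
  line_arrangement A
    (varx R * g 1 m (varx R) (vary R) * g 1 n (varx R) (varz R)) ->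
  at_most 2 (fun p : P2 R => (2 < multiplicity A p)%N).
Proof.
move=> arrA s us s2.
(* The candidates (0:0:1) and (0:1:0), compared with points of [P2] as subspaces. *)
pose pts : seq {vspace 'rV[R[i]]_3} := 
    [:: <[delta_mx 0%R o2]>; <[delta_mx 0%R o1]> ]%VS.
rewrite -[2%N]/(size pts) -(size_map val); apply: uniq_leq_size.
  by rewrite map_inj_uniq //; exact: val_inj.
move=> _ /mapP[p ps ->]; have := s2 p ps.
have [_ _ fE] := lines_arrangement m n.
have fw : (varx R * g 1 m (varx R) (vary R) * g 1 n (varx R) (varz R)).@[
    fun i => (i == o0)%:R] != 0.
  rewrite fE rmorph_prod big_map prodf_seq_neq0; apply/allP => t _ /=.
  by rewrite meval_line !oE eqxx !mulr0 !subr0 oner_eq0.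
(* The order of vanishing along (1,0,0) carries the count from [A] to the explicit list of lines. *)
rewrite (multiplicity_mup p arrA fw).
rewrite -(multiplicity_mup p (lines_arrangement m n) fw).
move=> /count_lines [p0 [p1|p2]]; rewrite !inE; apply/orP.
- left; apply/eqP/P2_coordinate_point.
  by apply: eq_ord3; rewrite ?eqxx.
- right; apply/eqP/P2_coordinate_point.
  by apply: eq_ord3; rewrite ?eqxx.
Qed.

End Arrangements.

Theorem theorem1p2 (R : realType) (d d1 : nat)
    (hd : (3 <= d)%N) (hd1 : (1 <= d1)%N) (hd1d : (2 * d1 < d)%N) :
  let d2 := (d - 1 - d1)%N in
  let x := varx R in let y := vary R in let z := varz R in
  let f := x * g 1 d1 x y * g 1 d2 x z in
  [/\ exists2 A : seq {mpoly R[i][3]}, line_arrangement A f & size A = d,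
      free_with_exponents f d1 d2
    & forall A : seq {mpoly R[i][3]}, line_arrangement A f ->
        at_most 2 (fun p : P2 R => (2 < multiplicity A p)%N)].
Proof.
move=> d2 x y z f; split.
- exists [seq line R t | t <- lines d1 d2]; first exact: lines_arrangement.
  by rewrite size_map size_lines /d2; lia.
- by apply: free_g; rewrite /d2; lia.
- by move=> A; exact: at_most_two_multiple_points.
Qed.
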